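(* The functor $\mathcal{F}^{\mathrm{OpSem}}_{\mathrm{Sem}}$ from semigroups to operated semigroups, $T\mapsto(\mathcal{F}(T),P_{\mathcal{F}(T)})$, is left adjoint to the forgetful functor $\mathcal{U}^{\mathrm{OpSem}}_{\mathrm{Sem}}$ from operated semigroups to semigroups.
   Context: An operated semigroup is a semigroup $S$ with a map $P_S:S\to S$ (not necessarily a homomorphism); morphisms are semigroup homomorphisms commuting with the maps. For a set $U$, $\mathcal{S}(U)$ is the free semigroup on $U$, and $\lfloor U\rfloor$ is the set of formal elements $\lfloor u\rfloor$, $u\in U$ (a disjoint copy of $U$). For a semigroup $T$ and a set $U$, $\tilde{\mathcal{S}}(T\sqcup U)$ is the quotient semigroup of $\mathcal{S}(T\sqcup U)$ (free semigroup on the disjoint union of the underlying set of $T$ and $U$) obtained by identifying, for all $t,t'\in T$, the product of $t,t'$ in $T$ with their product in $\mathcal{S}(T\sqcup U)$. An injective map $U\hookrightarrow U'$ induces an injective homomorphism $\tilde{\mathcal{S}}(T\sqcup U)\to\tilde{\mathcal{S}}(T\sqcup U')$. For a semigroup $T$ put $\mathcal{F}_0(T)=T$ and $\mathcal{F}_n(T)=\tilde{\mathcal{S}}(T\sqcup\lfloor\mathcal{F}_{n-1}(T)\rfloor)$ for $n\ge1$. Let $i_{0,1}:\mathcal{F}_0(T)\hookrightarrow\mathcal{F}_1(T)$ be induced by the inclusion $T\hookrightarrow T\sqcup\lfloor T\rfloor$, and for $n\ge2$ let $i_{n-1,n}:\mathcal{F}_{n-1}(T)\hookrightarrow\mathcal{F}_n(T)$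 be induced by $\mathrm{Id}_T\sqcup\lfloor i_{n-2,n-1}\rfloor: T\sqcup\lfloor\mathcal{F}_{n-2}(T)\rfloor\hookrightarrow T\sqcup\lfloor\mathcal{F}_{n-1}(T)\rfloor$. Then $\mathcal{F}(T)=\varinjlim\mathcal{F}_n(T)$ (direct limit of semigroups), and $P_{\mathcal{F}(T)}$ is the operator induced by the maps $\mathcal{F}_n(T)\to\mathcal{F}_{n+1}(T)$, $u\mapsto\lfloor u\rfloor$. On morphisms the functor is defined by the evident functoriality of the construction. *)

(* Defs.v *)
From HB Require Import structures.
From mathcomp Require Import all_boot.
From mathcomp Require Import boolp.

Set Implicit Arguments.
Unset Strict Implicit.
Unset Printing Implicit Defensive.

Local Open Scope group_scope.
Local Open Scope quotient_scope.

Record category := Category {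
  obj :> Type;
  hom : obj -> obj -> Type;
  idm : forall a, hom a a;
  comp : forall a b c, hom b c -> hom a b -> hom a c;
  comp1m : forall a b (f : hom a b), comp (idm b) f = f;
  compm1 : forall a b (f : hom a b), comp f (idm a) = f;
  compA : forall a b c d (f : hom c d) (g : hom b c) (h : hom a b),
    comp f (comp g h) = comp (comp f g) h
}.
Arguments hom {c0} a b : rename.
Arguments idm {c0} a : rename.
Arguments comp {c0 a b c} f g : rename.

Record functor (C D : category) := Functor {
  fobj :> C -> D;
  fmap : forall a b : C, hom a b -> hom (fobj a) (fobj b);
  fmap1 : forall a, fmap (idm a) = idm (fobj a);
  fmap_comp : forall a b c (f : hom b c) (g : hom a b),
    fmap (comp f g) = comp (fmap f) (fmap g)
}.
Arguments fmap {C D} f {a b} g : rename.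

Definition left_adjoint (C D : category) (F : functor C D) (G : functor D C)
    : Prop :=
  exists phi : forall (c : C) (d : D), hom (F c) d -> hom c (G d),
    [/\ forall c d, bijective (phi c d),
        forall (c c' : C) (d : D) (u : hom c' c) (f : hom (F c) d),
          phi c' d (comp f (fmap F u)) = comp (phi c d f) u
      & forall (c : C) (d d' : D) (v : hom d d') (f : hom (F c) d),
          phi c d' (comp v f) = comp (fmap G v) (phi c d f)].

(* A [semigroupType] also carries a choice structure on its elements. Every
   type has one classically (see boolp), and morphisms ignore it. Its carrier
   may be empty. *)

HB.mixin Record hasOperator S := { oper : S -> S }.

#[short(type="operatedSemigroupType")]
HB.structure Definition OperatedSemigroup :=
  { S of hasOperator S & Semigroup S }.

HB.mixin Record isOperated (S S' : operatedSemigroupType) (f : S -> S') := {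
  operatedP : {morph f : x / oper x >-> oper x}
}.

HB.structure Definition OperatedMorphism (S S' : operatedSemigroupType) :=
  { f of isOperated S S' f & isMultiplicative S S' f }.

Lemma multiplicative_ext (S S' : semigroupType)
  (f g : {multiplicative S -> S'}) : f =1 g -> f = g.
Proof.
case: f g => [f [[fM]]] [g [[gM]]] /= /funext fg.
by subst g; rewrite (Prop_irrelevance fM gM).
Qed.

Lemma operated_ext (S S' : operatedSemigroupType)
  (f g : OperatedMorphism.type S S') : f =1 g -> f = g.
Proof.
case: f g => [f [[fP] [fM]]] [g [[gP] [gM]]] /= /funext fg.
by subst g; rewrite (Prop_irrelevance fM gM) (Prop_irrelevance fP gP).
Qed.

Section OperatedComp.
Variables (S1 S2 S3 : operatedSemigroupType).
Variables (f : OperatedMorphism.type S2 S3) (g : OperatedMorphism.type S1 S2).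

Lemma idfun_operated : {morph (@idfun S1) : x / oper x >-> oper x}.
Proof. by []. Qed.
HB.instance Definition _ := isOperated.Build S1 S1 idfun idfun_operated.

Lemma comp_operated : {morph (f \o g) : x / oper x >-> oper x}.
Proof. by move=> x /=; rewrite !operatedP. Qed.
HB.instance Definition _ := isOperated.Build S1 S3 (f \o g) comp_operated.
End OperatedComp.

Definition Sem : category.
Proof.
refine (@Category semigroupType (fun S S' => {multiplicative S -> S'})
  (fun S => idfun) (fun S1 S2 S3 f g => f \o g) _ _ _) => *;
  exact: multiplicative_ext.
Defined.

Definition OpSem : category.
Proof.
refine (@Category operatedSemigroupType
  (fun S S' => OperatedMorphism.type S S')
  (fun S => idfun) (fun S1 S2 S3 f g => f \o g) _ _ _) => *;
  exact: operated_ext.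
Defined.

Definition forget_OpSem_Sem : functor OpSem Sem.
Proof.
refine (@Functor OpSem Sem (fun S => S : semigroupType)
  (fun S S' f => f : {multiplicative S -> S'}) _ _) => *;
  exact: multiplicative_ext.
Defined.

(* Nonempty words: the pair [(u, s)] is the word [u :: s]. *)
Definition free_semigroup (U : Type) : Type := (U * seq U)%type.

HB.instance Definition _ (U : choiceType) :=
  Choice.copy (free_semigroup U) (U * seq U)%type.

Definition letter (U : Type) (u : U) : free_semigroup U := (u, [::]).

Definition concat (U : Type) (x y : free_semigroup U) : free_semigroup U :=
  (x.1, x.2 ++ y.1 :: y.2).

Lemma concatA (U : Type) : associative (@concat U).
Proof. by move=> [a s] [b t] [c w]; rewrite /concat /= -catA. Qed.

HB.instance Definition _ (U : choiceType) :=
  isSemigroup.Build (free_semigroup U) (@concatA U).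

Lemma free_semigroup_ind (U : choiceType) (Q : free_semigroup U -> Prop) :
  (forall u, Q (letter u)) -> (forall u x, Q x -> Q (letter u * x)) ->
  forall x, Q x.
Proof.
move=> Ql Qm [u s]; elim: s u => [|v s IHs] u; first exact: Ql.
exact: (Qm u (v, s)).
Qed.

Fixpoint free_lift_rec (U : Type) (S : magmaType) (h : U -> S) u s : S :=
  if s is v :: s' then h u * free_lift_rec h v s' else h u.

Definition free_lift (U : Type) (S : magmaType) (h : U -> S)
  (x : free_semigroup U) : S := free_lift_rec h x.1 x.2.

Lemma free_lift_letter (U : Type) (S : magmaType) (h : U -> S) u :
  free_lift h (letter u) = h u.
Proof. by []. Qed.

Lemma free_liftM (U : choiceType) (S : semigroupType) (h : U -> S) :
  {morph free_lift h : x y / x * y >-> x * y}.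
Proof.
move=> [a s] [b t]; rewrite /free_lift /=.
by elim: s a => [|c s IHs] a //=; rewrite IHs mulgA.
Qed.

Section Tilde.
Variables (T : semigroupType) (U : choiceType).
Implicit Types x y z : free_semigroup (T + U)%type.

(* Generated by [t * t' ~ t t'], for [t] and [t'] in [T]. *)
Inductive tilde_cong : free_semigroup (T + U)%type ->
    free_semigroup (T + U)%type -> Prop :=
| tilde_cong_base t t' :
    tilde_cong (letter (inl (t * t'))) (letter (inl t) * letter (inl t'))
| tilde_cong_mul x x' y y' :
    tilde_cong x x' -> tilde_cong y y' -> tilde_cong (x * y) (x' * y')
| tilde_cong_refl x : tilde_cong x x
| tilde_cong_sym x y : tilde_cong x y -> tilde_cong y x
| tilde_cong_trans x y z : tilde_cong x y -> tilde_cong y z -> tilde_cong x z.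

Definition tilde_rel : rel (free_semigroup (T + U)%type) :=
  fun x y => `[< tilde_cong x y >].

Lemma tilde_rel_refl : reflexive tilde_rel.
Proof. by move=> x; apply/asboolP; apply: tilde_cong_refl. Qed.

Lemma tilde_rel_sym : symmetric tilde_rel.
Proof.
by move=> x y; apply/idP/idP => /asboolP xy; apply/asboolP;
  apply: tilde_cong_sym.
Qed.

Lemma tilde_rel_trans : transitive tilde_rel.
Proof.
move=> y x z /asboolP xy /asboolP yz; apply/asboolP.
exact: tilde_cong_trans xy yz.
Qed.

Canonical tilde_equiv :=
  EquivRel tilde_rel tilde_rel_refl tilde_rel_sym tilde_rel_trans.

Definition tilde : Type := {eq_quot tilde_equiv}.
HB.instance Definition _ := Choice.on tilde.

Definition tilde_pi x : tilde := \pi_{eq_quot tilde_equiv} x.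
Definition tilde_repr (a : tilde) : free_semigroup (T + U)%type :=
  repr (a : {eq_quot tilde_equiv}).

Lemma tilde_reprK : cancel tilde_repr tilde_pi.
Proof. exact: reprK. Qed.

Lemma tilde_piP x y : tilde_pi x = tilde_pi y <-> tilde_cong x y.
Proof.
by split=> [/eqmodP/asboolP | ?] //;
  apply/eqmodP/asboolP.
Qed.

Lemma tilde_repr_pi x : tilde_cong (tilde_repr (tilde_pi x)) x.
Proof. by apply/tilde_piP; rewrite tilde_reprK. Qed.

Definition tilde_mul (a b : tilde) : tilde :=
  tilde_pi (tilde_repr a * tilde_repr b).

Lemma tilde_mul_pi x y : tilde_mul (tilde_pi x) (tilde_pi y) = tilde_pi (x * y).
Proof. by apply/tilde_piP/tilde_cong_mul; apply: tilde_repr_pi. Qed.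

Lemma tilde_mulA : associative tilde_mul.
Proof.
move=> a b c; rewrite -(tilde_reprK a) -(tilde_reprK b) -(tilde_reprK c).
by rewrite !tilde_mul_pi mulgA.
Qed.

HB.instance Definition _ := isSemigroup.Build tilde tilde_mulA.

Lemma tilde_piM : {morph tilde_pi : x y / x * y >-> x * y}.
Proof. by move=> x y; rewrite -tilde_mul_pi. Qed.

Definition tilde_inl (t : T) : tilde := tilde_pi (letter (inl t)).
Definition tilde_inr (u : U) : tilde := tilde_pi (letter (inr u)).

Lemma tilde_inlM : {morph tilde_inl : t t' / t * t' >-> t * t'}.
Proof. by move=> t t'; rewrite -tilde_piM; apply/tilde_piP/tilde_cong_base. Qed.

HB.instance Definition _ := isMultiplicative.Build T tilde tilde_inl tilde_inlM.

Lemma tilde_ind (Q : tilde -> Prop) :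
  (forall t, Q (tilde_inl t)) -> (forall u, Q (tilde_inr u)) ->
  (forall a b, Q a -> Q b -> Q (a * b)) -> forall a, Q a.
Proof.
move=> Ql Qr Qm a; rewrite -(tilde_reprK a).
have Qletter v : Q (tilde_pi (letter v)) by case: v.
elim/free_semigroup_ind: (tilde_repr a) => [v|v x Qx]; first exact: Qletter.
by rewrite tilde_piM; apply: Qm.
Qed.

End Tilde.

Lemma eq_tilde_multiplicative (T : semigroupType) (U : choiceType)
  (S : semigroupType) (f g : {multiplicative tilde T U -> S}) :
  (forall t, f (tilde_inl U t) = g (tilde_inl U t)) ->
  (forall u, f (tilde_inr T u) = g (tilde_inr T u)) -> f =1 g.
Proof.
move=> fgl fgr; elim/tilde_ind=> // a b fga fgb.
by rewrite !gmulfM fga fgb.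
Qed.

Section TildeLift.
Variables (T : semigroupType) (U : choiceType) (S : semigroupType).
Variables (f : {multiplicative T -> S}) (g : U -> S).

Definition sum_lift (v : T + U) : S :=
  match v with inl t => f t | inr u => g u end.

Definition tilde_lift (a : tilde T U) : S := free_lift sum_lift (tilde_repr a).

Lemma tilde_lift_cong x y :
  tilde_cong x y -> free_lift sum_lift x = free_lift sum_lift y.
Proof.
elim=> {x y} [t t'|x x' y y' _ xx' _ yy'|//|x y _ -> //|x y z _ -> _ -> //].
  by rewrite free_liftM !free_lift_letter /= gmulfM.
by rewrite !free_liftM xx' yy'.
Qed.

Lemma tilde_lift_pi x : tilde_lift (tilde_pi x) = free_lift sum_lift x.
Proof. exact/tilde_lift_cong/tilde_repr_pi. Qed.

Lemma tilde_lift_inl t : tilde_lift (tilde_inl U t) = f t.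
Proof. by rewrite tilde_lift_pi. Qed.

Lemma tilde_lift_inr u : tilde_lift (tilde_inr T u) = g u.
Proof. by rewrite tilde_lift_pi. Qed.

Lemma tilde_liftM : {morph tilde_lift : a b / a * b >-> a * b}.
Proof.
move=> a b; rewrite -(tilde_reprK a) -(tilde_reprK b) -tilde_piM.
by rewrite !tilde_lift_pi free_liftM.
Qed.

HB.instance Definition _ :=
  isMultiplicative.Build (tilde T U) S tilde_lift tilde_liftM.

End TildeLift.

Definition tilde_map (T T' : semigroupType) (U U' : choiceType)
    (f : {multiplicative T -> T'}) (g : U -> U') :
    {multiplicative tilde T U -> tilde T' U'} :=
  tilde_lift (@tilde_inl T' U' \o f) (@tilde_inr T' U' \o g).

Section TildeMap.
Variables (T T' : semigroupType) (U U' : choiceType).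
Variables (f : {multiplicative T -> T'}) (g : U -> U').

Lemma tilde_map_inl t : tilde_map f g (tilde_inl U t) = tilde_inl U' (f t).
Proof. exact: tilde_lift_inl. Qed.

Lemma tilde_map_inr u : tilde_map f g (tilde_inr T u) = tilde_inr T' (g u).
Proof. exact: tilde_lift_inr. Qed.

End TildeMap.

Variant bracket (U : Type) : Type := Bracket of U.

Definition unbracket (U : Type) (b : bracket U) : U := let: Bracket u := b in u.

Lemma unbracketK (U : Type) : cancel (@unbracket U) (@Bracket U).
Proof. by case. Qed.

HB.instance Definition _ (U : choiceType) :=
  Choice.copy (bracket U) (can_type (@unbracketK U)).

Definition bracket_map (U U' : Type) (g : U -> U') (b : bracket U) :
  bracket U' := Bracket (g (unbracket b)).

Section DirectLimit.
Variables (A : nat -> semigroupType).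
Variables (i_ : forall n, {multiplicative A n -> A n.+1}).

Fixpoint shift n k : A n -> A (k + n)%N :=
  if k is k'.+1 then fun x => i_ (k' + n) (shift k' x) else id.

Definition trans n m (le_nm : (n <= m)%N) (x : A n) : A m :=
  ecast j (A j) (subnK le_nm) (shift (m - n) x).

Lemma transE n k (le_nk : (n <= k + n)%N) x : trans le_nk x = shift k x.
Proof.
rewrite /trans; move: (subnK le_nk); rewrite addnK => e.
by rewrite eq_axiomK.
Qed.

Lemma trans_id n (le_nn : (n <= n)%N) x : trans le_nn x = x.
Proof. exact: (@transE n 0). Qed.

Lemma transS n m (le_nm : (n <= m)%N) (le_nSm : (n <= m.+1)%N) x :
  trans le_nSm x = i_ m (trans le_nm x).
Proof.
have [k e] : {k | m = k + n}%N by exists (m - n)%N; rewrite subnK.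
subst m; rewrite transE; exact: (@transE n k.+1).
Qed.

Lemma trans_trans n m k (le_nm : (n <= m)%N) (le_mk : (m <= k)%N)
  (le_nk : (n <= k)%N) x : trans le_mk (trans le_nm x) = trans le_nk x.
Proof.
have [l e] : {l | k = l + m}%N by exists (k - m)%N; rewrite subnK.
subst k; elim: l => [|l IHl] in le_mk le_nk *.
  by rewrite trans_id; congr trans; apply: bool_irrelevance.
have le1 : (m <= l + m)%N by rewrite leq_addl.
have le2 : (n <= l + m)%N by apply: leq_trans le1.
by rewrite (@transS m (l + m) le1 le_mk) (IHl _ le2) (@transS n (l + m) le2 le_nk).
Qed.

Lemma transM n m (le_nm : (n <= m)%N) :
  {morph trans le_nm : x y / x * y >-> x * y}.
Proof.
move=> x y.
have [k e] : {k | m = k + n}%N by exists (m - n)%N; rewrite subnK.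
subst m; rewrite !transE; elim: k {le_nm} => //= k IHk.
by rewrite IHk gmulfM.
Qed.

Definition colim_pre : Type := {n : nat & A n}.
HB.instance Definition _ :=
  Choice.copy colim_pre {n : nat & (A n : choiceType)}.

Definition colim_eqv (x y : colim_pre) : Prop :=
  exists k (hx : (tag x <= k)%N) (hy : (tag y <= k)%N),
    trans hx (tagged x) = trans hy (tagged y).

Definition colim_rel : rel colim_pre := fun x y => `[< colim_eqv x y >].

Lemma colim_rel_refl : reflexive colim_rel.
Proof. by move=> x; apply/asboolP; exists (tag x), (leqnn _), (leqnn _). Qed.

Lemma colim_rel_sym : symmetric colim_rel.
Proof.
by move=> x y; apply/idP/idP => /asboolP[k [hx [hy e]]]; apply/asboolP;
  exists k, hy, hx.
Qed.

Lemma colim_rel_trans : transitive colim_rel.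
Proof.
move=> y x z /asboolP[k [hx [hy e]]] /asboolP[l [hy' [hz e']]]; apply/asboolP.
have hk : (k <= maxn k l)%N by apply: leq_maxl.
have hl : (l <= maxn k l)%N by apply: leq_maxr.
exists (maxn k l), (leq_trans hx hk), (leq_trans hz hl).
rewrite -(trans_trans hx hk) -(trans_trans hz hl) e -e'.
by rewrite !(trans_trans _ _ (leq_trans hy hk)).
Qed.

Canonical colim_equiv :=
  EquivRel colim_rel colim_rel_refl colim_rel_sym colim_rel_trans.

Definition colim : Type := {eq_quot colim_equiv}.
HB.instance Definition _ := Choice.on colim.

Definition colim_in n (x : A n) : colim :=
  \pi_{eq_quot colim_equiv} (Tagged (fun n => A n : Type) x : colim_pre).

Definition colim_repr (a : colim) : colim_pre :=
  repr (a : {eq_quot colim_equiv}).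

Lemma colim_reprK (a : colim) : colim_in (tagged (colim_repr a)) = a.
Proof.
rewrite /colim_in.
by rewrite (_ : Tagged _ _ = colim_repr a) ?[LHS]reprK //; case: colim_repr.
Qed.

Lemma colim_inP n m (x : A n) (y : A m) :
  colim_in x = colim_in y <->
  exists k (hx : (n <= k)%N) (hy : (m <= k)%N), trans hx x = trans hy y.
Proof.
by split=> [/eqmodP/asboolP | ?] //;
  apply/eqmodP/asboolP.
Qed.

Lemma colim_in_trans n m (le_nm : (n <= m)%N) (x : A n) :
  colim_in (trans le_nm x) = colim_in x.
Proof.
by apply/colim_inP; exists m, (leqnn m), le_nm; rewrite trans_id.
Qed.

Lemma colim_inS n (x : A n) : colim_in (i_ n x) = colim_in x.
Proof.
by rewrite -[x in LHS](trans_id (leqnn n)) -(transS _ (leqnSn n)) colim_in_trans.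
Qed.

Lemma colim_ind (Q : colim -> Prop) :
  (forall n (x : A n), Q (colim_in x)) -> forall a, Q a.
Proof. by move=> Qin a; rewrite -(colim_reprK a). Qed.

Definition colim_mul (a b : colim) : colim :=
  let x := colim_repr a in let y := colim_repr b in
  colim_in (trans (leq_maxl (tag x) (tag y)) (tagged x) *
            trans (leq_maxr (tag x) (tag y)) (tagged y)).

Lemma colim_mul_in n (x y : A n) :
  colim_mul (colim_in x) (colim_in y) = colim_in (x * y).
Proof.
rewrite /colim_mul.
case: (colim_repr (colim_in x)) (colim_reprK (colim_in x)) => p x' /= ex.
case: (colim_repr (colim_in y)) (colim_reprK (colim_in y)) => q y' /= ey.
have /colim_inP[k [hp [hn e]]] := ex; have /colim_inP[l [hq [hn' e']]] := ey.
pose N := maxn (maxn p q) (maxn k l).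
have hpqN : (maxn p q <= N)%N by apply: leq_maxl.
have hkN : (k <= N)%N by rewrite !leq_max leqnn !orbT.
have hlN : (l <= N)%N by rewrite !leq_max leqnn !orbT.
have hnN := leq_trans hn hkN.
apply/colim_inP; exists N, hpqN, hnN.
rewrite !transM (trans_trans _ _ (leq_trans hp hkN)).
rewrite (trans_trans _ _ (leq_trans hq hlN)).
rewrite -(trans_trans hp hkN) -(trans_trans hq hlN) e e'.
by rewrite !(trans_trans _ _ hnN).
Qed.

Lemma colim_in2 (a b : colim) :
  exists n (x y : A n), a = colim_in x /\ b = colim_in y.
Proof.
rewrite -(colim_reprK a) -(colim_reprK b).
set x := tagged _; set y := tagged _.
exists (maxn (tag (colim_repr a)) (tag (colim_repr b))),
  (trans (leq_maxl _ _) x), (trans (leq_maxr _ _) y).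
by rewrite !colim_in_trans.
Qed.

Lemma colim_mulA : associative colim_mul.
Proof.
move=> a b c; have [n [x [y [-> ->]]]] := colim_in2 a b.
elim/colim_ind: c => m z.
have hn := leq_maxl n m; have hm := leq_maxr n m.
rewrite -(colim_in_trans hn x) -(colim_in_trans hn y) -(colim_in_trans hm z).
by rewrite !colim_mul_in mulgA.
Qed.

HB.instance Definition _ := isSemigroup.Build colim colim_mulA.

Lemma colim_inM n : {morph @colim_in n : x y / x * y >-> x * y}.
Proof. by move=> x y; rewrite -colim_mul_in. Qed.

HB.instance Definition _ n :=
  isMultiplicative.Build (A n) colim (@colim_in n) (@colim_inM n).

Definition colim_lift (R : Type) (h : forall n, A n -> R) (a : colim) : R :=
  h (tag (colim_repr a)) (tagged (colim_repr a)).

Lemma colim_lift_in (R : Type) (h : forall n, A n -> R) :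
  (forall n x, h n.+1 (i_ n x) = h n x) ->
  forall n (x : A n), colim_lift h (colim_in x) = h n x.
Proof.
move=> hi n x.
have h_trans m k (le_mk : (m <= k)%N) y : h k (trans le_mk y) = h m y.
  have [l e] : {l | k = l + m}%N by exists (k - m)%N; rewrite subnK.
  by subst k; rewrite transE; elim: l {le_mk} => //= l IHl; rewrite hi IHl.
have /colim_inP[k [hp [hn e]]] := colim_reprK (colim_in x).
by rewrite /colim_lift -(h_trans _ _ hp) e h_trans.
Qed.

End DirectLimit.

Fixpoint stage (T : semigroupType) (n : nat) : semigroupType :=
  if n is m.+1 then tilde T (bracket (stage T m)) else T.

Fixpoint stage_incl (T : semigroupType) (n : nat) :
    {multiplicative stage T n -> stage T n.+1} :=
  match n with
  | 0 => @tilde_inl T (bracket T)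
  | m.+1 => tilde_map idfun (bracket_map (stage_incl T m))
  end.

Fixpoint stage_map (T T' : semigroupType) (f : {multiplicative T -> T'})
    (n : nat) : {multiplicative stage T n -> stage T' n} :=
  match n with
  | 0 => f
  | m.+1 => tilde_map f (bracket_map (stage_map f m))
  end.

Definition stage_oper (T : semigroupType) (n : nat) (u : stage T n) :
  stage T n.+1 := tilde_inr T (Bracket u).

Lemma stage_oper_incl (T : semigroupType) n (u : stage T n) :
  stage_oper (stage_incl T n u) = stage_incl T n.+1 (stage_oper u).
Proof. by rewrite [RHS]tilde_map_inr. Qed.

Lemma stage_map_oper (T T' : semigroupType) (f : {multiplicative T -> T'}) n
  (u : stage T n) : stage_map f n.+1 (stage_oper u) = stage_oper (stage_map f n u).
Proof. exact: tilde_map_inr. Qed.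

Lemma stage_map_incl (T T' : semigroupType) (f : {multiplicative T -> T'}) n
  (u : stage T n) :
  stage_map f n.+1 (stage_incl T n u) = stage_incl T' n (stage_map f n u).
Proof.
elim: n u => [|n IHn] u; first exact: tilde_map_inl.
apply: (@eq_tilde_multiplicative _ _ _ (stage_map f n.+2 \o stage_incl T n.+1)
  (stage_incl T' n.+1 \o stage_map f n.+1)) u => [t|[v]] /=.
  by rewrite !tilde_map_inl.
by rewrite !tilde_map_inr /bracket_map /= -IHn.
Qed.

Definition free_operated (T : semigroupType) : Type := colim (stage_incl T).
HB.instance Definition _ (T : semigroupType) := Semigroup.on (free_operated T).

Definition free_oper (T : semigroupType) : free_operated T -> free_operated T :=
  colim_lift (fun n u => colim_in (stage_incl T) (stage_oper u)).
HB.instance Definition _ (T : semigroupType) :=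
  hasOperator.Build (free_operated T) (@free_oper T).

Lemma free_oper_in (T : semigroupType) n (u : stage T n) :
  oper (colim_in (stage_incl T) u : free_operated T) =
  colim_in (stage_incl T) (stage_oper u).
Proof.
apply: (colim_lift_in (i_ := stage_incl T)) => {u} m u.
by rewrite stage_oper_incl colim_inS.
Qed.

Section FreeMap.
Variables (T T' : semigroupType) (f : {multiplicative T -> T'}).

Definition free_operated_map : free_operated T -> free_operated T' :=
  colim_lift (fun n u => colim_in (stage_incl T') (stage_map f n u)).

Lemma free_operated_map_in n (u : stage T n) :
  free_operated_map (colim_in (stage_incl T) u) =
  colim_in (stage_incl T') (stage_map f n u).
Proof.
apply: (colim_lift_in (i_ := stage_incl T)) => {u} m u.
by rewrite stage_map_incl colim_inS.
Qed.

Lemma free_operated_mapM : {morph free_operated_map : x y / x * y >-> x * y}.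
Proof.
move=> a b; have [n [x [y [-> ->]]]] := colim_in2 a b.
by rewrite -colim_inM !free_operated_map_in gmulfM colim_inM.
Qed.

Lemma free_operated_map_oper :
  {morph free_operated_map : x / oper x >-> oper x}.
Proof.
move=> a; elim/colim_ind: a => n x.
by rewrite free_oper_in !free_operated_map_in free_oper_in stage_map_oper.
Qed.

HB.instance Definition _ := isMultiplicative.Build
  (free_operated T) (free_operated T') free_operated_map free_operated_mapM.
HB.instance Definition _ := isOperated.Build
  (free_operated T) (free_operated T') free_operated_map free_operated_map_oper.

End FreeMap.

Lemma stage_map_id (T : semigroupType) n : stage_map (@idfun T) n =1 id.
Proof.
elim: n => [//|n IHn].
apply: (@eq_tilde_multiplicative _ _ _ (stage_map idfun n.+1) idfun) => [t|[v]].
  exact: tilde_map_inl.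
by rewrite /= tilde_map_inr /bracket_map /= IHn.
Qed.

Lemma stage_map_comp (T1 T2 T3 : semigroupType) (f : {multiplicative T2 -> T3})
  (g : {multiplicative T1 -> T2}) n :
  stage_map (f \o g) n =1 stage_map f n \o stage_map g n.
Proof.
elim: n => [//|n IHn].
apply: (@eq_tilde_multiplicative _ _ _ (stage_map (f \o g) n.+1)
  (stage_map f n.+1 \o stage_map g n.+1)) => [t|[v]] /=.
  by rewrite !tilde_map_inl.
by rewrite !tilde_map_inr /bracket_map /= IHn.
Qed.

Definition free_Sem_OpSem : functor Sem OpSem.
Proof.
refine (@Functor Sem OpSem
  (fun T => (free_operated T : operatedSemigroupType))
  (fun T T' f => free_operated_map f) _ _).
- move=> T; apply: operated_ext => a; elim/colim_ind: a => n x /=.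
  by rewrite free_operated_map_in stage_map_id.
- move=> T1 T2 T3 f g; apply: operated_ext => a; elim/colim_ind: a => n x /=.
  by rewrite !free_operated_map_in stage_map_comp.
Defined.

(* Main.v *)
From HB Require Import structures.
From mathcomp Require Import all_boot.
Require Import Defs.

Set Implicit Arguments.
Unset Strict Implicit.
Unset Printing Implicit Defensive.

Local Open Scope group_scope.

(** The homomorphism [free_unit] from [T], as stage 0, to the colimit is a
    universal arrow from [T] to the forgetful functor, and restriction along it
    is the adjunction bijection.

    Existence of extensions ([free_ext]): a homomorphism [f : T -> S] into an
    operated semigroup extends stage by stage.  Stage [n.+1] is generated by
    [T] and the brackets of stage [n], subject only to the multiplication table
    of [T], so [tilde_lift] allows the value [f t] on [t] and the forced value
    [oper (g u)] on the bracket of [u], where [g] is the extension to stage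
    [n].  These extensions are compatible with the inclusions of the stages and
    glue to an operated morphism on the colimit.

    Uniqueness ([free_operated_hom_ext]): the colimit is generated by [T] under
    product and operator ([free_operated_ind]), so an operated morphism is
    determined by its restriction to [T].

    Naturality in the operated semigroup is associativity of composition, and
    naturality in the semigroup holds because the image of a homomorphism under
    the functor restricts to it on stage 0. *)

Section Unit.
Variable T : semigroupType.

Definition free_unit : T -> free_operated T := @colim_in _ (stage_incl T) 0.
HB.instance Definition _ := isMultiplicative.Build T (free_operated T)
  free_unit (@colim_inM _ (stage_incl T) 0).

(** Each stage after the first contains its own copy of [T]; the inclusions of
    the stages respect these copies, so in the colimit they coincide. *)
Lemma colim_in_inl n t :
  @colim_in _ (stage_incl T) n.+1 (tilde_inl _ t) = free_unit t.
Proof.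
elim: n => [|n IHn]; first exact: (@colim_inS _ (stage_incl T) 0).
rewrite -IHn -(@colim_inS _ (stage_incl T) n.+1); congr colim_in.
exact/esym/tilde_map_inl.
Qed.

(** The two generating families of a stage become, in the colimit, elements of
    [T] and images under the operator of elements from the stage below. *)
Lemma free_operated_ind (Q : free_operated T -> Prop) :
  (forall t, Q (free_unit t)) -> (forall a, Q a -> Q (oper a)) ->
  (forall a b, Q a -> Q b -> Q (a * b)) -> forall a, Q a.
Proof.
move=> Qt Qo Qm; elim/colim_ind; elim=> [|n IHn]; first exact: Qt.
elim/tilde_ind => [t|[u]|a b Qa Qb]; first by rewrite colim_in_inl.
- by rewrite -[tilde_inr _ _]/(stage_oper u) -free_oper_in; apply/Qo/IHn.
- by rewrite colim_inM; apply: Qm.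
Qed.

Lemma free_operated_hom_ext (S : operatedSemigroupType)
    (f g : OperatedMorphism.type (free_operated T) S) :
  f \o free_unit =1 g \o free_unit -> f = g.
Proof.
move=> fg; apply: operated_ext; elim/free_operated_ind => [//|a fga|a b fga fgb].
  by rewrite !operatedP fga.
by rewrite !gmulfM /= fga fgb.
Qed.

End Unit.

Lemma free_operated_map_unit (T T' : semigroupType)
  (f : {multiplicative T -> T'}) t :
  free_operated_map f (free_unit t) = free_unit (f t).
Proof. exact: free_operated_map_in. Qed.

Section Extension.
Variables (T : semigroupType) (S : operatedSemigroupType).
Variable f : {multiplicative T -> S}.

Fixpoint stage_ext (n : nat) : {multiplicative stage T n -> S} :=
  match n with
  | 0 => f
  | m.+1 => tilde_lift f (fun b => oper (stage_ext m (unbracket b)))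
  end.

Lemma stage_ext_oper n (u : stage T n) :
  stage_ext n.+1 (stage_oper u) = oper (stage_ext n u).
Proof. exact: tilde_lift_inr. Qed.

Lemma stage_ext_incl n (u : stage T n) :
  stage_ext n.+1 (stage_incl T n u) = stage_ext n u.
Proof.
elim: n u => [|n IHn] u; first exact: tilde_lift_inl.
apply: (@eq_tilde_multiplicative _ _ _ (stage_ext n.+2 \o stage_incl T n.+1)
  (stage_ext n.+1)) u => [t|[v]] /=.
  by rewrite tilde_map_inl !tilde_lift_inl.
by rewrite tilde_map_inr !tilde_lift_inr /= -IHn.
Qed.

Definition free_ext : free_operated T -> S := colim_lift stage_ext.

Lemma free_ext_in n (u : stage T n) :
  free_ext (colim_in (stage_incl T) u) = stage_ext n u.
Proof. exact: colim_lift_in stage_ext_incl _ _. Qed.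

Lemma free_ext_unit t : free_ext (free_unit t) = f t.
Proof. exact: free_ext_in. Qed.

Lemma free_extM : {morph free_ext : a b / a * b >-> a * b}.
Proof.
move=> a b; have [n [x [y [-> ->]]]] := colim_in2 a b.
by rewrite -colim_inM !free_ext_in gmulfM.
Qed.

Lemma free_ext_oper : {morph free_ext : a / oper a >-> oper a}.
Proof.
elim/colim_ind=> n x.
by rewrite free_oper_in !free_ext_in stage_ext_oper.
Qed.

HB.instance Definition _ :=
  isMultiplicative.Build (free_operated T) S free_ext free_extM.
HB.instance Definition _ :=
  isOperated.Build (free_operated T) S free_ext free_ext_oper.

End Extension.

Theorem proposition2p4 : left_adjoint free_Sem_OpSem forget_OpSem_Sem.
Proof.
exists (fun (T : semigroupType) (S : operatedSemigroupType)
  (f : OperatedMorphism.type (free_operated T) S) =>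
  (f \o @free_unit T : {multiplicative T -> S})).
split=> [T S|T T' S u f|T S S' v f].
- exists (fun f : {multiplicative T -> S} =>
    free_ext f : OperatedMorphism.type (free_operated T) S) => f.
  + by apply: free_operated_hom_ext => t /=; rewrite free_ext_unit.
  + by apply: multiplicative_ext => t /=; rewrite free_ext_unit.
- by apply: multiplicative_ext => t /=; rewrite free_operated_map_unit.
- exact: multiplicative_ext.
Qed.
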